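(* Let $T\in\mathcal{B}(l^2(\mathbb{N}))$ have quasi-banded subdiagonals with respect to $f$ and let $T_n$ be the $n$-th element in the IQR iteration, i.e. $T_n=Q_n^*\cdots Q_1^*TQ_1\cdots Q_n$, where $Q_j$ is the strong operator limit $Q_j=\lim_{l\to\infty}U^j_1\cdots U^j_l$ and each $U^j_l$ is a Householder transformation (the superscript is an index, not a power). Let $P_m$ be the orthogonal projection onto $\mathrm{span}\{e_j\}_{j=1}^m$ and denote the $a$-fold iteration of $f$ by $f_a=\underbrace{f\circ f\circ\cdots\circ f}_{a\text{ times}}$. Then $$\begin{aligned}P_mT_nP_m={}&P_mU^n_m\cdots U^n_1\,U^{n-1}_{f_1(m)}\cdots U^{n-1}_1\cdots U^2_{f_{(n-2)}(m)}\cdots U^2_1\,U^1_{f_{(n-1)}(m)}\cdots U^1_1\\&\cdot P_{f_n(m)}TP_{f_n(m)}\\&\cdot U^1_1\cdots U^1_{f_{(n-1)}(m)}\,U^2_1\cdots U^2_{f_{(n-2)}(m)}\cdots U^{n-1}_1\cdots U^{n-1}_{f_1(m)}\,U^n_1\cdots U^n_mP_m.\end{aligned}$$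
   Context: $\{e_j\}_{j\in\mathbb{N}}$ is the canonical orthonormal basis of $l^2(\mathbb{N})$. Quasi-banded subdiagonals: for $f:\mathbb{N}\to\mathbb{N}$ non-decreasing with $f(n)\ge n$, $T$ has quasi-banded subdiagonals with respect to $f$ if $\langle Te_j,e_i\rangle=0$ when $i>f(j)$. Householder transformations: an operator of the form $U=I_1\oplus(I_2-\frac{2}{\|\xi\|^2}\xi\otimes\bar\xi)$ on $\mathcal{H}_1\oplus\mathcal{H}_2$, with $\xi\in\mathcal{H}_2$ and $(\xi\otimes\bar\xi)x=\langle x,\xi\rangle\xi$; one has $U=U^*=U^{-1}$. QR decomposition via Householder transformations: given a bounded $B$, construct inductively $U_1,U_2,\dots$ as follows. $U_l$ acts as the identity on $\mathrm{span}\{e_1,\dots,e_{l-1}\}$ and, on $\mathcal{H}_2=\overline{\mathrm{span}\{e_k\}_{k\ge l}}$, as the reflection that maps $\eta_l$, the orthogonal projection onto $\mathcal{H}_2$ of $U_{l-1}\cdots U_1Be_l$, to a multiple of $e_l$, i.e. with $\xi=\eta_l\pm\|\eta_l\|\zeta$, where $\zeta=\frac{\langle\eta_l,e_l\rangle}{|\langle\eta_l,e_l\rangle|}e_l$ if $\langle\eta_l,e_l\rangle\ne0$ and $\zeta=e_l$ otherwise (if $\xi=0$, the reflection is taken to be the identity). Then $U_1\cdots U_l$ converges strongly to an isometry $Q$ and $B=QR$ with $R$ upper triangular ($\langle Re_j,e_i\rangle=0$ for $i>j$). IQR iteration: $T_0=T$; $T_{j-1}=Q_jR_j$ is the QR decomposition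 just described, with Householder transformations $U^j_1,U^j_2,\dots$, and $T_j=R_jQ_j$. *)

(* Defs.v *)
From HB Require Import structures.
From mathcomp Require Import all_boot all_order all_algebra.
From mathcomp Require Import all_classical all_reals all_analysis.
From mathcomp Require Import complex ring lra.

Set Implicit Arguments.
Unset Strict Implicit.
Unset Printing Implicit Defensive.
Import Order.TTheory GRing.Theory Num.Theory numFieldNormedType.Exports.
Local Open Scope classical_set_scope.
Local Open Scope ring_scope.
Local Open Scope complex_scope.

Section SquareSummable.
Variable R : realType.
Implicit Types (u v : nat -> R[i]) (z : R[i]).

Definition sq_summable u : Prop :=
  cvgn (series (fun k => Normc.normc (u k) ^+ 2)).

Definition sq_sum u : R := limn (series (fun k => Normc.normc (u k) ^+ 2)).

Lemma normc_sqE z : Normc.normc z ^+ 2 = complex.Re z ^+ 2 + complex.Im z ^+ 2.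
Proof. by case: z => a b /=; rewrite sqr_sqrtr// addr_ge0 ?sqr_ge0. Qed.

Lemma normc_sq_ge0 z : 0 <= Normc.normc z ^+ 2.
Proof. by rewrite normc_sqE addr_ge0 ?sqr_ge0. Qed.

Lemma sq_summable0 : sq_summable 0.
Proof.
rewrite /sq_summable; have -> : series (fun k => Normc.normc ((0 : nat -> R[i]) k) ^+ 2) = cst 0.
  apply/funext => n; rewrite /series/= big1// => i _.
  by rewrite /= !expr0n addr0 sqrtr0 expr0n.
exact: is_cvg_cst.
Qed.

Lemma normc_sqD (c : R) z w : 0 < c ->
  Normc.normc (z + w) ^+ 2 <=
  (1 + c) * Normc.normc z ^+ 2 + (1 + c^-1) * Normc.normc w ^+ 2.
Proof.
move=> c0; rewrite !normc_sqE; case: z w => [a b] [x y] /=.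
rewrite -subr_ge0.
have -> : (1 + c) * (a ^+ 2 + b ^+ 2) + (1 + c^-1) * (x ^+ 2 + y ^+ 2) -
   ((a + x) ^+ 2 + (b + y) ^+ 2) =
   c^-1 * ((c * a - x) ^+ 2 + (c * b - y) ^+ 2).
  by field; rewrite gt_eqF.
by rewrite mulr_ge0 ?invr_ge0 ?(ltW c0)// addr_ge0 ?sqr_ge0.
Qed.

Lemma normc_sqZ z w : Normc.normc (z * w) ^+ 2 = Normc.normc z ^+ 2 * Normc.normc w ^+ 2.
Proof. by rewrite Normc.normcM exprMn. Qed.

Lemma normc_sq_seqZ z u :
  (fun k => Normc.normc ((z *: u) k) ^+ 2) =
  Normc.normc z ^+ 2 *: (fun k => Normc.normc (u k) ^+ 2) :> (nat -> R).
Proof. by apply/funext => k; exact: normc_sqZ. Qed.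

Lemma sq_summableZ z u : sq_summable u -> sq_summable (z *: u).
Proof. by move=> su; rewrite /sq_summable normc_sq_seqZ; exact: is_cvg_seriesZ. Qed.

Lemma sq_sumZ z u : sq_summable u ->
  sq_sum (z *: u) = Normc.normc z ^+ 2 * sq_sum u.
Proof. by move=> su; rewrite /sq_sum normc_sq_seqZ; exact: lim_seriesZ. Qed.

Lemma sq_summableD_aux (c : R) u v : 0 < c -> sq_summable u -> sq_summable v ->
  sq_summable (u + v) /\
  sq_sum (u + v) <= (1 + c) * sq_sum u + (1 + c^-1) * sq_sum v.
Proof.
move=> c0 su sv.
pose U := (1 + c) *: (fun k => Normc.normc (u k) ^+ 2).
pose V := (1 + c^-1) *: (fun k => Normc.normc (v k) ^+ 2).
have cU : cvgn (series U) by exact: is_cvg_seriesZ.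
have cV : cvgn (series V) by exact: is_cvg_seriesZ.
have cUV : cvgn (series (U + V)) by exact: is_cvg_seriesD.
have uvUV k : Normc.normc ((u + v) k) ^+ 2 <= (U + V) k by exact: normc_sqD.
have suv : sq_summable (u + v).
  apply: (series_le_cvg _ _ _ cUV) => k //; first exact: normc_sq_ge0.
  exact: le_trans (normc_sq_ge0 _) (uvUV k).
split=> //; apply: (@le_trans _ _ (limn (series (U + V)))).
  exact: lim_series_le.
by rewrite lim_seriesD// !lim_seriesZ.
Qed.

Lemma sq_summableD u v : sq_summable u -> sq_summable v -> sq_summable (u + v).
Proof. by move=> su sv; have [] := sq_summableD_aux ltr01 su sv. Qed.

Lemma normc_sq_le_sum u k : sq_summable u -> Normc.normc (u k) ^+ 2 <= sq_sum u.
Proof.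
move=> su; apply: (@le_trans _ _ (series (fun k => Normc.normc (u k) ^+ 2) k.+1)).
  rewrite /series/= big_nat_recr//= lerDr sumr_ge0// => i _.
  exact: normc_sq_ge0.
apply: nondecreasing_cvgn_le => //.
by apply: nondecreasing_series => i _ _; exact: normc_sq_ge0.
Qed.

Lemma sq_sum_ge0 u : sq_summable u -> 0 <= sq_sum u.
Proof. by move=> /(normc_sq_le_sum 0); exact/le_trans/normc_sq_ge0. Qed.

Lemma sq_sum_eq0 u : sq_summable u -> sq_sum u = 0 -> u = 0.
Proof.
move=> su u0; apply/funext => k; apply: Normc.eq0_normc.
apply/eqP; rewrite -sqrf_eq0 eq_le normc_sq_ge0 andbT -u0.
exact: normc_sq_le_sum.
Qed.

Lemma sq_sumD u v : sq_summable u -> sq_summable v ->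
  Num.sqrt (sq_sum (u + v)) <= Num.sqrt (sq_sum u) + Num.sqrt (sq_sum v).
Proof.
move=> su sv; set s := Num.sqrt (sq_sum u); set t := Num.sqrt (sq_sum v).
have sE : sq_sum u = s ^+ 2 by rewrite sqr_sqrtr ?sq_sum_ge0.
have tE : sq_sum v = t ^+ 2 by rewrite sqr_sqrtr ?sq_sum_ge0.
have [s0|s0] := eqVneq s 0.
  have -> : u = 0 by apply: sq_sum_eq0; rewrite // sE s0 expr0n.
  by rewrite s0 !add0r.
have [t0|t0] := eqVneq t 0.
  have -> : v = 0 by apply: sq_sum_eq0; rewrite // tE t0 expr0n.
  by rewrite t0 !addr0.
have sp : 0 < s by rewrite lt_neqAle eq_sym s0 sqrtr_ge0.
have tp : 0 < t by rewrite lt_neqAle eq_sym t0 sqrtr_ge0.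
have [_] := sq_summableD_aux (divr_gt0 tp sp) su sv; rewrite sE tE.
have -> : (1 + t / s) * s ^+ 2 + (1 + (t / s)^-1) * t ^+ 2 = (s + t) ^+ 2.
  by field; rewrite s0.
move=> /ler_wsqrtr /le_trans; apply.
by rewrite sqrtr_sqr ger0_norm// addr_ge0// ltW.
Qed.

Definition sq_summable_pred : {pred nat -> R[i]} := fun u => `[< sq_summable u >].

Lemma sq_summable_submod_closed : submod_closed sq_summable_pred.
Proof.
split; first exact/asboolP/sq_summable0.
move=> z u v /asboolP su /asboolP sv; apply/asboolP.
by apply: sq_summableD => //; exact: sq_summableZ.
Qed.
HB.instance Definition _ := GRing.isSubmodClosed.Build _ _ sq_summable_pred
  sq_summable_submod_closed.

End SquareSummable.

(* The complex Hilbert space l^2(N).  The basis is numbered from 1: coordinate *)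
(* k : nat of x : l2 R is the coefficient of the basis vector e_(k+1).         *)
Record l2 (R : realType) := L2 {
  l2_coord :> nat -> R[i];
  l2_coordP : l2_coord \in @sq_summable_pred R
}.

Section L2Space.
Variable R : realType.

HB.instance Definition _ := [isSub for @l2_coord R].
HB.instance Definition _ := [Choice of l2 R by <:].
HB.instance Definition _ := [SubChoice_isSubLmodule of l2 R by <:].

Lemma l2_summable (x : l2 R) : sq_summable x.
Proof. exact/asboolP/l2_coordP. Qed.

Definition l2norm (x : l2 R) : R[i] := (Num.sqrt (sq_sum x))%:C.

Lemma l2normD (x y : l2 R) : l2norm (x + y) <= l2norm x + l2norm y.
Proof.
rewrite /l2norm -rmorphD lecR; apply: sq_sumD; exact: l2_summable.
Qed.

Lemma l2normZ (z : R[i]) (x : l2 R) : l2norm (z *: x) = `|z| * l2norm x.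
Proof.
rewrite /l2norm sq_sumZ; last exact: l2_summable.
rewrite sqrtrM ?normc_sq_ge0// sqrtr_sqr ger0_norm; last by case: z => *; exact: sqrtr_ge0.
by rewrite rmorphM; case: z.
Qed.

Lemma l2norm_eq0 (x : l2 R) : l2norm x = 0 -> x = 0.
Proof.
move=> /complexI /eqP; rewrite sqrtr_eq0 => x0; apply: val_inj.
apply: sq_sum_eq0; first exact: l2_summable.
by apply/eqP; rewrite eq_le x0/= sq_sum_ge0//; exact: l2_summable.
Qed.

HB.instance Definition _ := @Lmodule_isNormed.Build R[i] (l2 R)
  l2norm l2normD l2normZ l2norm_eq0.

(* sum_k x_k conj(y_k), the series in R[i] being summed componentwise. *)
Definition inner (x y : l2 R) : R[i] :=
  limn (series (fun k => complex.Re (x k * (y k)^*))) +i*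
  limn (series (fun k => complex.Im (x k * (y k)^*))).

Definition delta_seq (j : nat) : nat -> R[i] := fun k => (k.+1 == j)%:R.

Lemma delta_seq_summable j : delta_seq j \in @sq_summable_pred R.
Proof.
apply/asboolP; apply/cvg_ex.
exists (series (fun k => Normc.normc (delta_seq j k) ^+ 2) j).
apply: cvg_near_cst; near=> n.
have jn : (j <= n)%N by near: n; exact: nbhs_infty_ge.
rewrite /series/= (@big_cat_nat _ _ _ j)//=.
rewrite [X in _ + X]big_nat_cond [X in _ + X]big1 ?addr0// => k /andP[/andP[jk _] _].
by rewrite /delta_seq gtn_eqF// Normc.normc0 expr0n.
Unshelve. all: by end_near. Qed.

(* e_j for j >= 1; note ebasis 0 = 0. *)
Definition ebasis (j : nat) : l2 R := L2 (delta_seq_summable j).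

(* The orthogonal projection P_m onto span{e_1, ..., e_m}. *)
Definition span_proj (m : nat) (x : l2 R) : l2 R :=
  \sum_(1 <= j < m.+1) inner x (ebasis j) *: ebasis j.

Definition bounded_operator (A : l2 R -> l2 R) : Prop :=
  linear A /\ exists M : R[i], forall x, `|A x| <= M * `|x|.

Definition is_adjoint (A A' : l2 R -> l2 R) : Prop :=
  forall x y, inner (A x) y = inner x (A' y).

(* The operator products A_1 A_2 ... A_l and A_l ... A_2 A_1. *)
Fixpoint prod_up (A : nat -> l2 R -> l2 R) (l : nat) : l2 R -> l2 R :=
  if l is l'.+1 then prod_up A l' \o A l else id.
Fixpoint prod_down (A : nat -> l2 R -> l2 R) (l : nat) : l2 R -> l2 R :=
  if l is l'.+1 then A l \o prod_down A l' else id.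

Definition strong_limit (A : nat -> l2 R -> l2 R) (B : l2 R -> l2 R) : Prop :=
  forall x, A l x @[l --> \oo] --> B x.

Definition quasi_banded (f : nat -> nat) (T : l2 R -> l2 R) : Prop :=
  forall i j, (0 < j)%N -> (f j < i)%N -> inner (T (ebasis j)) (ebasis i) = 0.

(* I - (2/||xi||^2) xi (x) conj(xi); it is the identity when xi = 0. *)
Definition reflection (xi y : l2 R) : l2 R :=
  y - (2 / `|xi| ^+ 2 * inner y xi) *: xi.

(* I_1 (+) reflection xi, on the sum of H_1 = span{e_1, ..., e_(l-1)} and its  *)
(* orthogonal complement H_2, the closed span of the e_k with k >= l.          *)
Definition householder (l : nat) (xi x : l2 R) : l2 R :=
  span_proj l.-1 x + reflection xi (x - span_proj l.-1 x).

Definition phase_vec (l : nat) (eta : l2 R) : l2 R :=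
  if inner eta (ebasis l) != 0
  then (inner eta (ebasis l) / `|inner eta (ebasis l)|) *: ebasis l else ebasis l.

(* U_1, U_2, ... are the transformations built from B; the boolean s is the    *)
(* choice of sign in xi, free at every step.                                   *)
Definition householder_seq (B : l2 R -> l2 R) (U : nat -> l2 R -> l2 R) : Prop :=
  forall l, (0 < l)%N ->
    let b := prod_down U l.-1 (B (ebasis l)) in
    let eta := b - span_proj l.-1 b in
    exists s : bool,
      U l =1 householder l (eta + (-1) ^+ s *: (`|eta| *: phase_vec l eta)).

(* Triangularity of Rt and isometry of Q follow from the three conditions. *)
Definition householder_QR (B : l2 R -> l2 R) (U : nat -> l2 R -> l2 R)
    (Q Rt : l2 R -> l2 R) : Prop :=
  [/\ householder_seq B U, strong_limit (prod_up U) Q & B =1 Q \o Rt].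

(* Ts j, U j l, Q j, Rs j stand for T_j, U^j_l, Q_j, R_j. *)
Definition IQR_iteration (T : l2 R -> l2 R) (Ts : nat -> l2 R -> l2 R)
    (U : nat -> nat -> l2 R -> l2 R) (Q Rs : nat -> l2 R -> l2 R) : Prop :=
  Ts 0%N =1 T /\
  forall j, (0 < j)%N ->
    householder_QR (Ts j.-1) (U j) (Q j) (Rs j) /\ Ts j =1 Rs j \o Q j.

End L2Space.

Arguments ebasis {R} j.
Arguments span_proj {R} m x.

(* Main.v *)
Require Import Defs.
From HB Require Import structures.
From mathcomp Require Import all_boot all_order all_algebra.
From mathcomp Require Import all_classical all_reals all_analysis.
From mathcomp Require Import complex ring lra.

Set Implicit Arguments.
Unset Strict Implicit.
Unset Printing Implicit Defensive.
Import Order.TTheory GRing.Theory Num.Theory numFieldNormedType.Exports.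
Local Open Scope ring_scope.

(** Every Householder transformation is a self-adjoint involution, and [U_l] is
    supported on the coordinates [>= l]; hence on [ran P_m] the limit [Q] is
    already [U_1 ... U_m].  If [B] maps [ran P_m] into [ran P_(f m)] for every
    [m], the vectors defining [U_1, ..., U_m] lie in [ran P_(f m)], so [Q] has the
    same mapping property, and so has [R Q] since [R] is upper triangular.  Thus
    all iterates are quasi-banded, and [Q_1 ... Q_n P_m] is a finite product of
    Householder transformations with range in [ran P_(f_n m)].  Since
    [Q_1 ... Q_n T_n = T Q_1 ... Q_n] and the [Q_j] preserve inner products,
    [<T_n u, w> = <T Q_1 ... Q_n u, Q_1 ... Q_n w>] for [u, w] in [ran P_m], which
    gives the formula without using the adjoints of the [Q_j]. *)

(** * Inner product and coordinates on $l^2(\mathbb{N})$ *)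

Section InnerProduct.
Variable R : realType.
Implicit Types (x y z : l2 R) (a : R[i]).

Lemma l2P x y : (forall k, x k = y k) -> x = y.
Proof. by move=> xy; apply: val_inj; apply/funext. Qed.

Lemma l2_addE x y k : (x + y) k = x k + y k. Proof. by []. Qed.
Lemma l2_oppE x k : (- x) k = - x k. Proof. by []. Qed.
Lemma l2_scaleE a x k : (a *: x) k = a * x k. Proof. by []. Qed.
Lemma l2_zeroE k : (0 : l2 R) k = 0. Proof. by []. Qed.
Definition l2E := (l2_addE, l2_oppE, l2_scaleE, l2_zeroE).

(** Gives convergence of both series in [inner]: the real and imaginary parts of $x_k\overline{y_k}$
    are bounded in absolute value by $|x_k|^2+|y_k|^2$. *)
Lemma is_cvg_series_dominated x y (u : nat -> R) :
  (forall k, `|u k| <= Normc.normc (x k) ^+ 2 + Normc.normc (y k) ^+ 2) ->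
  cvgn (series u).
Proof.
move=> uxy; apply: normed_cvg.
apply: (series_le_cvg _ _ uxy) => [k|k|] //.
  by rewrite addr_ge0 ?normc_sq_ge0.
by apply: is_cvg_seriesD; exact: l2_summable.
Qed.

Lemma is_cvg_inner_Re x y : cvgn (series (fun k => complex.Re (x k * (y k)^*))).
Proof.
apply: (@is_cvg_series_dominated x y) => k; rewrite !normc_sqE.
case: (x k) (y k) => [a b] [c d] /=; rewrite ler_norml.
(* The real part is $ac+bd$; expanding $(a\mp c)^2+(b\mp d)^2\ge 0$ bounds it from both sides. *)
have := sqr_ge0 (a - c); have := sqr_ge0 (b - d).
by have := sqr_ge0 (a + c); have := sqr_ge0 (b + d); nra.
Qed.

Lemma is_cvg_inner_Im x y : cvgn (series (fun k => complex.Im (x k * (y k)^*))).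
Proof.
apply: (@is_cvg_series_dominated x y) => k; rewrite !normc_sqE.
case: (x k) (y k) => [a b] [c d] /=; rewrite ler_norml.
have := sqr_ge0 (a - d); have := sqr_ge0 (b - c).
by have := sqr_ge0 (a + d); have := sqr_ge0 (b + c); nra.
Qed.

(** The arguments are swapped so that [innerl y] can carry a linear structure, which makes
    [linear_sum] and [linear0] available for [inner]. *)
Definition innerl y x := inner x y.

Lemma innerl_linear y : linear_for *%R (innerl y).
Proof.
move=> a u v; rewrite /innerl /inner.
have ReE : (fun k => complex.Re ((a *: u + v) k * (y k)^*)) =
    (complex.Re a *: (fun k => complex.Re (u k * (y k)^*))
     + (- complex.Im a) *: (fun k => complex.Im (u k * (y k)^*)))
    + (fun k => complex.Re (v k * (y k)^*)) :> (nat -> R).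
  apply/funext => k; rewrite !l2E /= !fctE.
  case: a (u k) (v k) (y k) => [? ?] [? ?] [? ?] [? ?] /=.
  by rewrite /GRing.scale/=; ring.
have ImE : (fun k => complex.Im ((a *: u + v) k * (y k)^*)) =
    (complex.Re a *: (fun k => complex.Im (u k * (y k)^*))
     + complex.Im a *: (fun k => complex.Re (u k * (y k)^*)))
    + (fun k => complex.Im (v k * (y k)^*)) :> (nat -> R).
  apply/funext => k; rewrite !l2E /= !fctE.
  clear ReE; case: a (u k) (v k) (y k) => [? ?] [? ?] [? ?] [? ?] /=.
  by rewrite /GRing.scale/=; ring.
have lim_lin (b c : R) (p q r : nat -> R) :
    cvgn (series p) -> cvgn (series q) -> cvgn (series r) ->
    limn (series ((b *: p + c *: q) + r)) =
    b * limn (series p) + c * limn (series q) + limn (series r).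
  move=> cp cq cr; have cbp := is_cvg_seriesZ (k := b) cp.
  have ccq := is_cvg_seriesZ (k := c) cq.
  rewrite (lim_seriesD (is_cvg_seriesD cbp ccq) cr).
  by rewrite lim_seriesD// !lim_seriesZ.
have cRe := is_cvg_inner_Re ^~ y; have cIm := is_cvg_inner_Im ^~ y.
rewrite ReE ImE (lim_lin _ _ _ _ _ (cRe u) (cIm u) (cRe v)).
rewrite (lim_lin _ _ _ _ _ (cIm u) (cRe u) (cIm v)).
clear ReE ImE; case: a => a b; apply/eqP; rewrite eq_complex/=.
by apply/andP; split; apply/eqP; rewrite /GRing.scale/=; ring.
Qed.
HB.instance Definition _ y := GRing.isLinear.Build R[i] (l2 R) R[i] *%R
  (innerl y) (innerl_linear y).

Lemma innerDl x y z : inner (x + y) z = inner x z + inner y z.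
Proof. exact: (linearD (innerl z)). Qed.
Lemma innerBl x y z : inner (x - y) z = inner x z - inner y z.
Proof. exact: (linearB (innerl z)). Qed.
Lemma innerZl a x y : inner (a *: x) y = a * inner x y.
Proof. exact: (linearZ_LR (innerl y)). Qed.

Lemma innerC x y : inner y x = (inner x y)^*.
Proof.
rewrite /inner; set u := series _; set v := series _.
set u' := series _; set v' := series _.
have -> : u = u'.
  apply: congr1; apply/funext => k.
  by case: (x k) (y k) => [? ?] [? ?] /=; ring.
have -> : v = series (-1 *: (fun k => complex.Im (x k * (y k)^*))).
  apply: congr1; apply/funext => k; rewrite fctE /GRing.scale/=.
  by case: (x k) (y k) => [? ?] [? ?] /=; ring.
rewrite lim_seriesZ; last exact: is_cvg_inner_Im.
by rewrite scaleN1r.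
Qed.

Lemma innerDr x y z : inner z (x + y) = inner z x + inner z y.
Proof. by rewrite ![inner z _]innerC innerDl rmorphD. Qed.
Lemma innerBr x y z : inner z (x - y) = inner z x - inner z y.
Proof. by rewrite ![inner z _]innerC innerBl rmorphB. Qed.
Lemma innerZr a x y : inner x (a *: y) = a^* * inner x y.
Proof. by rewrite ![inner x _]innerC innerZl rmorphM. Qed.

Lemma inner_norm x : inner x x = `|x| ^+ 2.
Proof.
have -> : `|x| = (Num.sqrt (sq_sum x))%:C%C by [].
rewrite -rmorphXn/= sqr_sqrtr; last by apply/sq_sum_ge0/l2_summable.
rewrite /inner; set u := series _; set v := series _.
have -> : u = series (fun k => Normc.normc (x k) ^+ 2).
  apply: congr1; apply/funext => k; rewrite normc_sqE.
  by case: (x k) => [? ?] /=; ring.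
have -> : v = cst 0; last by rewrite lim_cst.
apply/funext => n; rewrite /v /series/= big1// => k _.
by case: (x k) => [? ?] /=; ring.
Qed.

Lemma ebasisE j k : ebasis j k = (k.+1 == j)%:R :> R[i]. Proof. by []. Qed.

(** The partial sums are constant beyond index [k]. The shift arises because basis vectors count
    from 1 and coordinates from 0. *)
Lemma inner_ebasis x k : inner x (ebasis k.+1) = x k.
Proof.
have lim_delta (u : nat -> R) : (forall j, j != k -> u j = 0) ->
    limn (series u) = u k.
  move=> u0; apply: cvg_lim => //; apply: cvg_near_cst; near=> n.
  have kn : (k < n)%N by near: n; exact: nbhs_infty_gt.
  rewrite /series/= big_mkord (bigD1 (Ordinal kn))//= big1 ?addr0// => j jk.
  by apply: u0; apply: contraNN jk => /eqP jk; apply/eqP/val_inj.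
rewrite /inner !lim_delta.
- by rewrite !ebasisE eqxx rmorph_nat mulr1; case: (x k).
- by move=> j jk; rewrite ebasisE eqSS (negbTE jk) rmorph_nat mulr0.
- by move=> j jk; rewrite ebasisE eqSS (negbTE jk) rmorph_nat mulr0.
Unshelve. all: by end_near. Qed.

Lemma inner_eqP x y : (forall z, inner x z = inner y z) -> x = y.
Proof. by move=> xy; apply: l2P => k; rewrite -!inner_ebasis. Qed.

Lemma span_projE m x k : span_proj m x k = if (k < m)%N then x k else 0.
Proof.
rewrite -inner_ebasis /span_proj.
rewrite -[inner _ _]/(innerl _ _) linear_sum/= big_add1/= big_mkord.
under eq_bigr do rewrite /innerl innerZl !inner_ebasis ebasisE eqSS.
case: ltnP => km.
  rewrite (bigD1 (Ordinal km))//= eqxx mulr1 big1 ?addr0// => j jk.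
  case: eqP => [kj|_]; last by rewrite mulr0.
  by case/eqP: jk; exact: val_inj.
rewrite big1// => j _; case: eqP => [kj|_]; last by rewrite mulr0.
by have := ltn_ord j; rewrite -kj ltnNge km.
Qed.

End InnerProduct.

(** * Projections, reflections and isometries *)

Section Operators.
Variable R : realType.
Implicit Types (x y z xi eta : l2 R) (a : R[i]) (A : l2 R -> l2 R).

Lemma span_proj_linear m : linear (@span_proj R m).
Proof.
move=> a x y; apply: l2P => k; rewrite !l2E !span_projE !l2E.
by case: ifP => //; rewrite mulr0 addr0.
Qed.
HB.instance Definition _ m :=
  GRing.isLinear.Build R[i] (l2 R) (l2 R) *:%R (span_proj m) (span_proj_linear m).

Lemma span_proj_id m x : span_proj m (span_proj m x) = span_proj m x.
Proof. by apply: l2P => k; rewrite !span_projE; case: (k < m)%N. Qed.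

(** Throughout, [span_proj m x = x] encodes $x\in\mathrm{ran}\,P_m$; these ranges increase with
    [m]. *)
Lemma span_projS m p x : (m <= p)%N -> span_proj m x = x -> span_proj p x = x.
Proof.
move=> mp xm; apply: l2P => k; rewrite -xm !span_projE.
by case: ifP => // /negbT kp; case: ifP => // km; rewrite (leq_trans km mp) in kp.
Qed.

Lemma span_proj_coord0 m x k : span_proj m x = x -> (m <= k)%N -> x k = 0.
Proof. by move=> <- mk; rewrite span_projE ltnNge mk. Qed.

Lemma span_proj_adjoint m : is_adjoint (@span_proj R m) (span_proj m).
Proof.
have E x y : inner (span_proj m x) y =
    \sum_(1 <= j < m.+1) inner x (ebasis j) * inner (ebasis j) y.
  rewrite /span_proj -[LHS]/(innerl y _) linear_sum.
  by apply: eq_bigr => j _; exact: innerZl.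
move=> x y; rewrite [RHS]innerC !E rmorph_sum; apply: eq_bigr => j _.
by rewrite rmorphM mulrC [inner x _]innerC [inner _ y]innerC.
Qed.

Lemma span_proj_ebasis m j : (j <= m)%N -> span_proj m (@ebasis R j) = ebasis j.
Proof.
move=> jm; apply: l2P => k; rewrite span_projE ebasisE; case: ifP => // /negbT.
by rewrite -leqNgt => mk; rewrite gtn_eqF// ltnS (leq_trans jm mk).
Qed.

Lemma span_proj_ebasis0 m j : (m < j)%N -> span_proj m (@ebasis R j) = 0.
Proof.
move=> mj; apply: l2P => k; rewrite span_projE ebasisE l2E; case: ifP => // km.
by rewrite ltn_eqF// (leq_ltn_trans _ mj).
Qed.

(** Vectors of $\mathrm{ran}\,P_m$ are finite combinations of basis vectors, so an inclusion of
    ranges can be checked on the basis. *)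
Lemma span_proj_of_ebasis A m p x : linear A ->
  (forall j, (0 < j <= m)%N -> span_proj p (A (ebasis j)) = A (ebasis j)) ->
  span_proj m x = x -> span_proj p (A x) = A x.
Proof.
move=> A_linear Ae xm.
pose linA : {linear l2 R -> l2 R} :=
  HB.pack A (GRing.isLinear.Build _ _ _ _ A A_linear).
have -> : A x = \sum_(1 <= j < m.+1) inner x (ebasis j) *: A (ebasis j).
  rewrite -{1}xm -[A]/(linA : l2 R -> l2 R) linear_sum.
  by apply: eq_bigr => j _; rewrite linearZ.
rewrite linear_sum; apply: eq_big_nat => j jm.
by rewrite linearZ/= Ae.
Qed.

Lemma inner_self_eq0 x : (inner x x == 0) = (x == 0).
Proof. by rewrite inner_norm sqrf_eq0 normr_eq0. Qed.

Lemma innerxx_conj x : (inner x x)^* = inner x x.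
Proof. by rewrite -innerC. Qed.

Lemma reflectionE xi x :
  reflection xi x = x - (2 / inner xi xi * inner x xi) *: xi.
Proof. by rewrite /reflection inner_norm. Qed.

Lemma reflection_linear xi : linear (reflection xi).
Proof.
move=> a x y; apply: l2P => k.
by rewrite !reflectionE !l2E innerDl innerZl; ring.
Qed.

HB.instance Definition _ xi := GRing.isLinear.Build R[i] (l2 R) (l2 R) *:%R
  (reflection xi) (reflection_linear xi).

Lemma conjM (a b : R[i]) : (a * b)^* = a^* * b^*. Proof. exact: rmorphM. Qed.
Lemma conjV a : (a^-1)^* = (a^*)^-1. Proof. exact: fmorphV. Qed.

Lemma reflection_adjoint xi : is_adjoint (reflection xi) (reflection xi).
Proof.
move=> x y; rewrite !reflectionE innerBl innerBr innerZl innerZr.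
have realc : (2 / inner xi xi)^* = 2 / inner xi xi.
  by rewrite conjM conjV innerxx_conj rmorph_nat.
rewrite (innerC xi y) conjM realc conjCK.
by congr (_ - _); rewrite mulrAC.
Qed.

Lemma reflectionK xi : involutive (reflection xi).
Proof.
move=> x; have [->|xi0] := eqVneq xi 0.
  by rewrite !reflectionE !scaler0 !subr0.
apply: l2P => k; rewrite !reflectionE !l2E innerBl innerZl.
by field; rewrite inner_self_eq0.
Qed.

Lemma reflection_fixed xi m x : span_proj m xi = 0 -> span_proj m x = x ->
  reflection xi x = x.
Proof.
move=> xi0 xm; rewrite reflectionE.
have -> : inner x xi = 0.
  rewrite -xm span_proj_adjoint xi0 innerC -[inner 0 x]/(innerl x 0).
  by rewrite linear0 rmorph0.
by rewrite mulr0 scale0r subr0.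
Qed.

Lemma reflection_span_proj xi m x : span_proj m xi = xi -> span_proj m x = x ->
  span_proj m (reflection xi x) = reflection xi x.
Proof. by move=> xim xm; rewrite !reflectionE linearB linearZ/= xim xm. Qed.

(** A reflection along $\xi\in\mathcal{H}_2$ already fixes $\mathcal{H}_1$, so the direct sum can be
    replaced by one reflection of the whole space. *)
Lemma householderE l xi x : span_proj l.-1 xi = 0 ->
  householder l xi x = reflection xi x.
Proof.
move=> xi0; rewrite /householder [reflection _ _]linearB/=.
by rewrite (reflection_fixed xi0 (span_proj_id _ _)) addrC subrK.
Qed.

(* The value of the reflection prescribed by a Householder step: [|x|^2 = |y|^2]
   and [<x,y>] real give [|x-y|^2 = 2<x,x-y>]. *)
Lemma reflection_swap x y : inner x x = inner y y -> (inner x y)^* = inner x y ->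
  reflection (x - y) x = y.
Proof.
move=> nxy rxy; have [xy0|xy] := eqVneq (x - y) 0.
  by rewrite reflectionE xy0 scaler0 subr0; apply: subr0_eq.
apply: l2P => k; rewrite reflectionE !l2E.
have e : inner (x - y) (x - y) = 2 * inner x (x - y).
  by rewrite innerBl !innerBr -nxy (innerC x y) rxy; ring.
rewrite e; have n0 : inner x (x - y) != 0.
  by apply: contraNneq xy => n0; rewrite -inner_self_eq0 e n0 mulr0.
by field.
Qed.

Lemma phase_vec_unit l eta : (0 < l)%N ->
  inner (phase_vec l eta) (phase_vec l eta) = 1.
Proof.
case: l => // l _; have e1 : inner (@ebasis R l.+1) (ebasis l.+1) = 1.
  by rewrite inner_ebasis ebasisE eqxx.
rewrite /phase_vec; case: ifPn => // p0; set p := inner _ _ in p0 *.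
rewrite innerZl innerZr e1 mulr1 -normCK normf_div normr_id divff ?expr1n//.
by rewrite normr_eq0.
Qed.

(** The phase of $\zeta$ is chosen to make $\langle\eta,\zeta\rangle$ real, which is the second
    hypothesis of [reflection_swap]. *)
Lemma inner_phase_vec l eta :
  inner eta (phase_vec l eta) = `|inner eta (ebasis l)|.
Proof.
rewrite /phase_vec; case: ifPn => [p0|/negPn/eqP ->]; last by rewrite normr0.
set p := inner _ _ in p0 *.
rewrite innerZr -/p conjM conjV (CrealP (normr_real p)).
by rewrite mulrAC -[_ * p]mulrC -normCK expr2 mulfK// normr_eq0.
Qed.

Lemma span_proj_phase_vec l eta : span_proj l (phase_vec l eta) = phase_vec l eta.
Proof.
by rewrite /phase_vec; case: ifP => _; rewrite ?linearZ/= span_proj_ebasis.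
Qed.

Lemma span_proj_pred_phase_vec l eta : (0 < l)%N ->
  span_proj l.-1 (phase_vec l eta) = 0.
Proof.
move=> l0; have e0 : span_proj l.-1 (@ebasis R l) = 0.
  by apply: span_proj_ebasis0; rewrite prednK.
by rewrite /phase_vec; case: ifP => _; rewrite ?linearZ/= e0 ?scaler0.
Qed.

Lemma is_adjoint_prod (F G : nat -> l2 R -> l2 R) n :
  (forall j, (0 < j)%N -> is_adjoint (F j) (G j)) ->
  is_adjoint (prod_up F n) (prod_down G n).
Proof.
move=> FG; elim: n => // n IHn x y /=.
by rewrite IHn FG.
Qed.

Lemma is_adjoint_sym A B : is_adjoint A B -> is_adjoint B A.
Proof. by move=> AB x y; rewrite innerC -AB -innerC. Qed.

Lemma polarization x y : inner x y =
  (inner (x + y) (x + y) - inner (x - y) (x - y) +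
   'i%C * inner (x + 'i%C *: y) (x + 'i%C *: y)
   - 'i%C * inner (x - 'i%C *: y) (x - 'i%C *: y)) / 4.
Proof.
have ii : ('i%C : R[i]) * 'i%C = -1 by rewrite -expr2 sqr_i.
have ci : ('i%C : R[i])^* = - 'i%C.
  by rewrite -[LHS]/(conjc _) /=; apply/eqP; rewrite eq_complex/= oppr0 !eqxx.
rewrite !(innerBl, innerBr, innerDl, innerDr, innerZl, innerZr) ci.
set i := 'i%C in ii *.
(* The first equality holds with [i] as an indeterminate; only the second uses $i^2=-1$. *)
transitivity ((2 * inner x y + 2 * inner y x
  - 2 * (i * i) * inner x y + 2 * (i * i) * inner y x) / 4); last by field.
by rewrite ii; field.
Qed.

(** Norms pass easily to the strong limit $Q$; polarization then recovers inner products. *)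
Lemma isometry_inner A : linear A -> (forall x, `|A x| = `|x|) ->
  forall x y, inner (A x) (A y) = inner x y.
Proof.
move=> linA nA x y.
have AD u v : A u + A v = A (u + v) by rewrite -[u]scale1r linA !scale1r.
have AZ a u : a *: A u = A (a *: u).
  by apply: (@addIr _ (A 0)); rewrite -linA addr0 AD addr0.
have AB u v : A u - A v = A (u - v) by rewrite -(scaleN1r (A v)) AZ AD scaleN1r.
rewrite polarization [RHS]polarization !(AZ, AD, AB).
by rewrite !inner_norm !nA.
Qed.

Lemma isometry_injective A : linear A -> (forall x, `|A x| = `|x|) -> injective A.
Proof.
move=> linA nA x y Axy.
have AB : A (x - y) = 0.
  by rewrite -scaleN1r addrC linA Axy scaleN1r addNr.
by apply/eqP; rewrite -subr_eq0 -normr_eq0 -nA AB normr0.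
Qed.

End Operators.

(** * The Householder transformations built from one operator *)

Section HouseholderQR.
Variable R : realType.
Implicit Types (x y : l2 R).

(** Subspace form of quasi-banded subdiagonals,
    $A(\mathrm{ran}\,P_m)\subseteq\mathrm{ran}\,P_{f(m)}$, which can be chained under
    composition. *)
Definition banded_on_spans (f : nat -> nat) (A : l2 R -> l2 R) : Prop :=
  forall m x, (0 < m)%N -> span_proj m x = x -> span_proj (f m) (A x) = A x.

Section HouseholderSeq.
Variables (B : l2 R -> l2 R) (U : nat -> l2 R -> l2 R).
Hypothesis UB : householder_seq B U.

(** Collects what the later arguments use about $U_l$. The last clause locates $\xi$ through the
    vector it is computed from, and drives the propagation of bandedness. *)
Lemma householder_step l : (0 < l)%N -> exists xi : l2 R,
  let b := prod_down U l.-1 (B (ebasis l)) in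
  [/\ span_proj l.-1 xi = 0, U l =1 reflection xi, span_proj l (U l b) = U l b &
      forall p, (l <= p)%N -> span_proj p b = b -> span_proj p xi = xi].
Proof.
move=> l0; have [s] := UB l0; set b := prod_down _ _ _.
set eta := b - _; set zeta := phase_vec l eta; set xi := eta + _ => Uxi.
(* The intended image of $\eta$: $\xi=\eta-v$ with $\|v\|=\|\eta\|$ and $\langle\eta,v\rangle$ real,
   so [reflection_swap] sends $\eta$ to $v$. *)
pose v := (- ((-1) ^+ s * `|eta|)) *: zeta.
have xiE : xi = eta - v by rewrite /v scaleNr opprK -scalerA.
have eta0 : span_proj l.-1 eta = 0 by rewrite linearB/= span_proj_id subrr.
have xi0 : span_proj l.-1 xi = 0.
  by rewrite xiE linearB linearZ/= eta0 span_proj_pred_phase_vec// scaler0 subr0.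
have Ul : U l =1 reflection xi by move=> x; rewrite Uxi householderE.
have real_c : (- ((-1) ^+ s * `|eta|) : R[i])^* = - ((-1) ^+ s * `|eta|).
  by apply/CrealP; rewrite rpredN rpredM ?rpred_sign// ger0_real.
have Uleta : reflection xi eta = v.
  rewrite xiE reflection_swap//.
    rewrite /v innerZl innerZr phase_vec_unit// mulr1 real_c mulrNN.
    by rewrite mulrACA -expr2 -expr2 -signr_odd sqrr_sign mul1r inner_norm.
  by rewrite /v innerZr inner_phase_vec conjM conjCK real_c (CrealP (normr_real _)).
exists xi; split=> // [|p lp bp].
  (* Split $b=P_{l-1}b+\eta$: the first summand is fixed and the second goes to $v$, a multiple of
     $e_l$. *)
  have -> : U l b = span_proj l.-1 b + v.
    rewrite Ul -[b in LHS](subrK (span_proj l.-1 b)) [LHS]linearD/= Uleta addrC.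
    by rewrite (reflection_fixed xi0 (span_proj_id _ _)).
  rewrite linearD/= (span_projS (leq_pred l) (span_proj_id _ _)).
  by rewrite /v linearZ/= span_proj_phase_vec.
rewrite xiE /v linearB linearZ/= (span_projS lp (span_proj_phase_vec _ _)).
by rewrite linearB/= bp (span_projS (leq_trans (leq_pred l) lp) (span_proj_id _ _)).
Qed.

Lemma householder_adjoint l : (0 < l)%N -> is_adjoint (U l) (U l).
Proof.
move=> /householder_step[xi [_ Ul _ _]] x y; rewrite !Ul; exact: reflection_adjoint.
Qed.

Lemma householderK l : (0 < l)%N -> involutive (U l).
Proof. by move=> /householder_step[xi [_ Ul _ _]] x; rewrite !Ul reflectionK. Qed.

Lemma householder_linear l : (0 < l)%N -> linear (U l).
Proof.
move=> /householder_step[xi [_ Ul _ _]] a x y; rewrite !Ul; exact: reflection_linear.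
Qed.

Lemma householder_fixed l m x : (m < l)%N -> span_proj m x = x -> U l x = x.
Proof.
move=> ml xm; have [xi [xi0 Ul _ _]] := householder_step (leq_ltn_trans (leq0n _) ml).
rewrite Ul; apply: (reflection_fixed xi0); apply: (span_projS _ xm).
by rewrite -ltnS (ltn_predK ml).
Qed.

Lemma prod_up_adjoint m : is_adjoint (prod_up U m) (prod_down U m).
Proof. by apply: is_adjoint_prod => j; exact: householder_adjoint. Qed.

Lemma prod_upK m : cancel (prod_up U m) (prod_down U m).
Proof. by elim: m => // m IHm x /=; rewrite IHm householderK. Qed.

Lemma prod_up_linear m : linear (prod_up U m).
Proof. by elim: m => // m IHm a x y /=; rewrite householder_linear// IHm. Qed.

Lemma prod_up_norm m x : `|prod_up U m x| = `|x|.
Proof.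
apply/eqP; rewrite -(@eqrXn2 _ 2)// -!inner_norm.
by rewrite prod_up_adjoint prod_upK.
Qed.

(** In $U_1\cdots U_l$ the factors $U_l,\dots,U_{m+1}$ act first, and each fixes
    $\mathrm{ran}\,P_m$. *)
Lemma prod_up_stable l m x : (m <= l)%N -> span_proj m x = x ->
  prod_up U l x = prod_up U m x.
Proof.
move=> ml xm; elim: l ml => [|l IHl]; first by rewrite leqn0 => /eqP ->.
rewrite leq_eqVlt => /predU1P[->//|ml] /=.
by rewrite (householder_fixed ml xm) IHl.
Qed.

(** Step $l$ brings the $l$-th column into $\mathrm{ran}\,P_l$, where all later transformations act
    as the identity. *)
Lemma prod_down_triangular l m : (0 < l)%N -> (l <= m)%N ->
  span_proj l (prod_down U m (B (ebasis l))) = prod_down U m (B (ebasis l)).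
Proof.
case: l => // l _; have [xi [_ _ Ub _]] := householder_step (ltn0Sn l).
elim: m => // m IHm; rewrite ltnS leq_eqVlt => /predU1P[<-//|lm] /=.
by rewrite (householder_fixed (m := l.+1))// IHm.
Qed.

(** Strong induction on [l]: $Be_l$ lies in $\mathrm{ran}\,P_{f(l)}\subseteq\mathrm{ran}\,P_p$, the
    earlier $U_i$ preserve $\mathrm{ran}\,P_p$ because $f(i)\le f(l)\le p$, and so $\xi$ lies there
    too. *)
Lemma householder_banded f l p x :
  (forall a b, (0 < a)%N -> (a <= b)%N -> (f a <= f b)%N) ->
  (forall k, (0 < k)%N -> (k <= f k)%N) ->
  banded_on_spans f B -> (0 < l)%N -> (f l <= p)%N -> span_proj p x = x ->
  span_proj p (U l x) = U l x.
Proof.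
move=> f_mono f_ge fB; elim/ltn_ind: l p x => l IHl p x l0 flp xp.
have [xi [_ Ul _ xip]] := householder_step l0.
rewrite Ul; apply: reflection_span_proj => //; apply: xip.
  by rewrite (leq_trans (f_ge l l0)).
have : span_proj p (B (ebasis l)) = B (ebasis l).
  by apply: (span_projS flp); apply: fB => //; exact: span_proj_ebasis.
(* Induction on the number of factors applied to $Be_l$; the bound keeps each index below [l],
   within reach of the outer hypothesis. *)
have : (l.-1 < l)%N by rewrite prednK.
elim: l.-1 => // i IHi il Bp /=.
apply: IHl => //; last by apply: IHi => //; exact: ltnW.
by rewrite (leq_trans _ flp)// f_mono// ltnW.
Qed.

Lemma prod_up_banded f l p x :
  (forall a b, (0 < a)%N -> (a <= b)%N -> (f a <= f b)%N) ->
  (forall k, (0 < k)%N -> (k <= f k)%N) ->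
  banded_on_spans f B -> (0 < l)%N -> (f l <= p)%N -> span_proj p x = x ->
  span_proj p (prod_up U l x) = prod_up U l x.
Proof.
move=> f_mono f_ge fB; elim: l p x => // -[|l] IHl p x l0 flp xp /=.
  exact: householder_banded fB _ flp xp.
apply: IHl => //; last exact: householder_banded fB _ flp xp.
by apply: leq_trans flp; exact: f_mono.
Qed.

End HouseholderSeq.
End HouseholderQR.

(** * The factors $Q$ and $R$ of one step *)

Section QR.
Variable R : realType.
Implicit Types (x y : l2 R).
Variables (B : l2 R -> l2 R) (U : nat -> l2 R -> l2 R) (Q Rt : l2 R -> l2 R).
Hypothesis QR : householder_QR B U Q Rt.
Hypothesis linB : linear B.

Let UB : householder_seq B U. Proof. by case: QR. Qed.
Let limQ : strong_limit (prod_up U) Q. Proof. by case: QR. Qed.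
Let BE : B =1 Q \o Rt. Proof. by case: QR. Qed.

Lemma QR_Q_linear : linear Q.
Proof.
move=> a x y; apply: (norm_cvg_unique (@limQ _)).
apply: (@cvg_trans _ ((a *: prod_up U l x + prod_up U l y) @[l --> \oo])%classic).
  apply: near_eq_cvg; near=> l; by rewrite (prod_up_linear UB).
by apply: cvgD; [apply: cvgZl_tmp|]; exact: limQ.
Unshelve. all: by end_near. Qed.

Lemma QR_Q_norm x : `|Q x| = `|x|.
Proof.
apply: (norm_cvg_unique (cvg_norm (@limQ x))).
suff : (`|prod_up U l x| @[l --> \oo] --> `|x|)%classic by [].
by apply: cvg_near_cst; apply: nearW => l; rewrite (prod_up_norm UB).
Qed.

Lemma QR_Q_inner x y : inner (Q x) (Q y) = inner x y.
Proof. exact: (isometry_inner QR_Q_linear QR_Q_norm). Qed.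

Lemma QR_QE m x : span_proj m x = x -> Q x = prod_up U m x.
Proof.
move=> xm; apply: (norm_cvg_unique (@limQ _)).
apply: cvg_near_cst; near=> l; apply: (prod_up_stable UB) => //.
by near: l; exact: nbhs_infty_ge.
Unshelve. all: by end_near. Qed.

(** [Rt] is given only through $B=QR$; linearity is pulled back along the injective linear map
    $Q$. *)
Lemma QR_R_linear : linear Rt.
Proof.
move=> a x y; apply: (isometry_injective QR_Q_linear QR_Q_norm).
by rewrite -[LHS]BE linB QR_Q_linear !BE.
Qed.

(** On basis vectors, $\langle Re_j,e_i\rangle=\langle QRe_j,Qe_i\rangle=\langle Be_j,U_1\cdots
    U_ie_i\rangle=\langle U_i\cdots U_1Be_j,e_i\rangle$, which vanishes for $i>j$ by
    [prod_down_triangular]. *)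
Lemma QR_R_triangular m x : span_proj m x = x -> span_proj m (Rt x) = Rt x.
Proof.
apply: (span_proj_of_ebasis QR_R_linear) => j /andP[j0 jm].
apply: (span_projS jm).
apply: l2P => k; rewrite span_projE; case: ltnP => // jk.
rewrite -(inner_ebasis (Rt _)) -QR_Q_inner -[Q (Rt _)]BE.
rewrite (QR_QE (span_proj_ebasis R (leqnn k.+1))).
rewrite -(is_adjoint_sym (prod_up_adjoint UB _)) inner_ebasis.
by rewrite (span_proj_coord0 _ jk)// (prod_down_triangular UB)// ltnW.
Qed.

Lemma QR_Q_banded f m x :
  (forall a b, (0 < a)%N -> (a <= b)%N -> (f a <= f b)%N) ->
  (forall k, (0 < k)%N -> (k <= f k)%N) ->
  banded_on_spans f B -> (0 < m)%N -> span_proj m x = x ->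
  span_proj (f m) (Q x) = Q x.
Proof.
move=> f_mono f_ge fB m0 xm; rewrite (QR_QE xm).
apply: (prod_up_banded UB f_mono f_ge fB) => //.
exact: span_projS (f_ge _ m0) xm.
Qed.

End QR.

(** * The iterates $T_n$ and the products $Q_1\cdots Q_n$ *)

Section IQR.
Variable R : realType.
Implicit Types (x y : l2 R).
Variables (f : nat -> nat) (T : l2 R -> l2 R) (Ts : nat -> l2 R -> l2 R).
Variables (U : nat -> nat -> l2 R -> l2 R) (Q Rs : nat -> l2 R -> l2 R).
Hypothesis f_nondecreasing :
  forall a b : nat, (0 < a)%N -> (a <= b)%N -> (f a <= f b)%N.
Hypothesis f_ge : forall k : nat, (0 < k)%N -> (k <= f k)%N.
Hypothesis T_linear : linear T.
Hypothesis T_iqr : IQR_iteration T Ts U Q Rs.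

(** The range of [j] matters: with truncated subtraction, [n.+1 - j = (n - j).+1] holds only for
    [j <= n]. *)
Lemma eq_prod_up (A A' : nat -> l2 R -> l2 R) n :
  (forall j, (0 < j <= n)%N -> A j =1 A' j) -> prod_up A n =1 prod_up A' n.
Proof.
elim: n => // n IHn AA' x /=; rewrite AA' ?leqnn// IHn// => j /andP[j0 jn].
by apply: AA'; rewrite j0 leqW.
Qed.

Lemma quasi_banded_on_spans : quasi_banded f T -> banded_on_spans f T.
Proof.
move=> fT m x m0; apply: (span_proj_of_ebasis T_linear) => j /andP[j0 jm].
apply: l2P => k; rewrite span_projE; case: ltnP => // fk.
by rewrite -inner_ebasis fT// ltnS (leq_trans _ fk)// f_nondecreasing.
Qed.

Lemma IQR_QR j : householder_QR (Ts j) (U j.+1) (Q j.+1) (Rs j.+1).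
Proof. by have [] := T_iqr.2 j.+1 isT. Qed.

Lemma IQR_TsS j : Ts j.+1 =1 Rs j.+1 \o Q j.+1.
Proof. by have [] := T_iqr.2 j.+1 isT. Qed.

Lemma IQR_linear n : linear (Ts n).
Proof.
elim: n => [|n IHn] a x y; first by rewrite !T_iqr.1 T_linear.
rewrite !IQR_TsS/= (QR_Q_linear (IQR_QR n)).
exact: (QR_R_linear (IQR_QR n) IHn).
Qed.

Lemma IQR_banded n : banded_on_spans f T -> banded_on_spans f (Ts n).
Proof.
move=> fT; elim: n => [|n IHn] m x m0 xm; first by rewrite T_iqr.1 fT.
rewrite IQR_TsS; apply: (QR_R_triangular (IQR_QR n) (@IQR_linear n)).
exact: (QR_Q_banded (IQR_QR n) f_nondecreasing f_ge IHn m0 xm).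
Qed.

Lemma IQR_Q_inner n x y : inner (prod_up Q n x) (prod_up Q n y) = inner x y.
Proof.
by elim: n x y => // n IHn x y /=; rewrite IHn (QR_Q_inner (IQR_QR n)).
Qed.

(** The inductive step regroups $Q_{n+1}T_{n+1}=Q_{n+1}R_{n+1}Q_{n+1}=T_nQ_{n+1}$. *)
Lemma IQR_intertwine n x : prod_up Q n (Ts n x) = T (prod_up Q n x).
Proof.
elim: n x => [|n IHn] x /=; first exact: T_iqr.1.
by rewrite IQR_TsS -IHn; have [_ _ ->] := IQR_QR n.
Qed.

(** Apply $Q_n^*\cdots Q_1^*$ to the intertwining relation; preservation of inner products cancels
    it against $Q_1\cdots Q_n$. *)
Lemma IQR_conjugate (Qadj : nat -> l2 R -> l2 R) n :
  (forall j, (0 < j)%N -> is_adjoint (Q j) (Qadj j)) ->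
  Ts n =1 prod_down Qadj n \o T \o prod_up Q n.
Proof.
move=> Qadj_adj x /=; rewrite -IQR_intertwine; apply: inner_eqP => z.
by rewrite (is_adjoint_sym (is_adjoint_prod n Qadj_adj)) IQR_Q_inner.
Qed.

(** $Q_{n+1}$ acts first and moves $\mathrm{ran}\,P_m$ into $\mathrm{ran}\,P_{f(m)}$, so the
    induction hypothesis is used at [f m]. Thus $Q_j$ meets vectors of
    $\mathrm{ran}\,P_{f_{n-j}(m)}$ and needs that many factors. *)
Lemma IQR_prod_up_span n m x : banded_on_spans f T -> (0 < m)%N ->
  span_proj m x = x ->
  prod_up Q n x = prod_up (fun j => prod_up (U j) (iter (n - j) f m)) n x /\
  span_proj (iter n f m) (prod_up Q n x) = prod_up Q n x.
Proof.
move=> fT; elim: n m x => // n IHn m x m0 xm.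
have fm0 : (0 < f m)%N := leq_trans m0 (f_ge m0).
have [] := IHn _ (Q n.+1 x) fm0 (QR_Q_banded (IQR_QR n) f_nondecreasing f_ge
  (@IQR_banded n fT) m0 xm).
rewrite iterSr /= subnn/= -(QR_QE (IQR_QR n) xm) => -> ->; split=> //.
by apply: eq_prod_up => j /andP[_ jn]; rewrite subSn// iterSr.
Qed.

End IQR.

Theorem theorem4p3 (R : realType)
  (f : nat -> nat)
  (f_nondecreasing : forall a b : nat, (0 < a)%N -> (a <= b)%N -> (f a <= f b)%N)
  (f_ge : forall k : nat, (0 < k)%N -> (k <= f k)%N)
  (T : l2 R -> l2 R) (T_bounded : bounded_operator T)
  (T_banded : quasi_banded f T)
  (Ts : nat -> l2 R -> l2 R) (U : nat -> nat -> l2 R -> l2 R)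
  (Q Rs : nat -> l2 R -> l2 R)
  (T_iqr : IQR_iteration T Ts U Q Rs)
  (n m : nat) (n_gt0 : (0 < n)%N) (m_gt0 : (0 < m)%N) :
  (forall Qadj : nat -> l2 R -> l2 R,
      (forall j : nat, (0 < j)%N -> is_adjoint (Q j) (Qadj j)) ->
      Ts n =1 prod_down Qadj n \o T \o prod_up Q n) /\
  span_proj m \o Ts n \o span_proj m =1
    span_proj m \o prod_down (fun j => prod_down (U j) (iter (n - j) f m)) n
    \o (span_proj (iter n f m) \o T \o span_proj (iter n f m))
    \o prod_up (fun j => prod_up (U j) (iter (n - j) f m)) n \o span_proj m.
Proof.
have T_lin : linear T := T_bounded.1.
split=> [Qadj Qadj_adj|x /=]; first exact: (IQR_conjugate T_iqr).
set u := span_proj m x; set W := fun j => prod_down (U j) (iter (n - j) f m).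
set V := fun j => prod_up (U j) (iter (n - j) f m).
have VW : is_adjoint (prod_up V n) (prod_down W n).
  apply: is_adjoint_prod => -[//|j] _.
  by have [UB _ _] := IQR_QR T_iqr j; exact: (prod_up_adjoint UB).
have span (y : l2 R) : span_proj m (span_proj m y) = span_proj m y := span_proj_id _ _.
have fT : banded_on_spans f T := quasi_banded_on_spans f_nondecreasing T_lin T_banded.
have QV y := IQR_prod_up_span f_nondecreasing f_ge T_lin T_iqr n fT m_gt0 (span y).
apply: inner_eqP => z; rewrite !span_proj_adjoint.
have [QVx spanx] := QV x; have [QVz spanz] := QV z.
rewrite -(IQR_Q_inner T_iqr n) (IQR_intertwine T_iqr).
(* $Q_1\cdots Q_nP_mz$ lies in $\mathrm{ran}\,P_{f_n(m)}$, so this projection can be inserted and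
   moved to the left argument; the remaining finite product [V] follows as its adjoint [W]. *)
rewrite -spanz -span_proj_adjoint QVz -/V -(is_adjoint_sym VW).
by rewrite -/u in QVx spanx *; rewrite -QVx spanx.
Qed.
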